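(* The following problems are expressible in extensional ESO. (a) Surjective CSPs: for every finite structure $\mathbb B$ with a finite relational signature $\tau$, there is an extensional ESO $\tau$-sentence whose finite models are exactly the finite $\tau$-structures $\mathbb A$ that admit a surjective homomorphism to $\mathbb B$. (b) Graph sandwich problems: for every finite set $\mathcal F$ of finite graphs there is an extensional ESO $\{E,N\}$-sentence that describes the sandwich problem for $\mathcal F$-free graphs, i.e., an instance $(V,E,N)$ satisfies the sentence if and only if there is an $\mathcal F$-free graph $(V,E')$ with $E\subseteq E'$ and $E'\cap N=\varnothing$. (c) Orientation completion problems: for every finite set $\mathcal F$ of finite oriented graphs there is an extensional ESO $\{E,A'\}$-sentence such that a partially oriented graph $(V,E,A')$ satisfies the sentence if and only if it has an $\mathcal F$-free orientation completion. (d) Constraint topological sorting: for every aperiodic regular language $L$ over a finite alphabet $\Sigma$ there is an extensional ESO $(\Sigma\cup\{E\})$-sentence such that a finite directed acyclic graph whose vertices are labelled by letters of $\Sigma$ satisfies the sentence if and only if it has a topological sort for which the word obtained by reading the labels of the vertices in that order belongs to $L$.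
   Context: All signatures are finite and relational, and all structures have non-empty domains. An ESO $\tau$-sentence has the form $\exists R_1,\dots,R_k.\,\phi$, where $R_1,\dots,R_k\notin\tau$ and $\phi$ is a first-order $(\tau\cup\{R_1,\dots,R_k\})$-sentence. It is extensional if for every existentially quantified predicate $R$ there is a distinct symbol $R'\in\tau$ of the same arity such that the sentence contains a conjunct $\forall\bar x\,(R'(\bar x)\Rightarrow R(\bar x))$, and $R'$ does not appear anywhere else in the sentence. A graph is a set with a symmetric binary edge relation; an oriented graph is a digraph whose edge relation contains no pair $(x,y)$ together with $(y,x)$. A (di)graph is $\mathcal F$-free if no member of $\mathcal F$ embeds into it (as an induced sub(di)graph). An instance of a sandwich problem is a finite vertex set $V$ with a set $E$ of edges and a set $N$ of non-edges (both symmetric binary relations). A partially oriented graph $(V,E,A')$ consists of a finite graph $\mathbb G=(V,E)$ and a set $A'\subseteq E$ such that $(V,A')$ is an oriented graph. An $\mathcal F$-free orientation completion is a set $A$ with $A'\subseteq A$ such that $(V,A)$ is an oriented graph that does not embed any member of $\mathcal F$ and the symmetric closure of $A$ equals $E$. A topological sort of a directed acyclic graph with edge relation $E$ is a linear order $<$ on its vertices such that $(x,y)\in E$ implies $x<y$. In (d), each letter of $\Sigma$ is used as a unary relation symbol denoting the set of vertices labelled with that letter. Aperiodic regular languages are exactly the regular languages definable in first-order logic over words (with the order and unary letter predicates). *)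

(* Defs.v *)
From HB Require Import structures.
From mathcomp Require Import all_boot.

Set Implicit Arguments.
Unset Strict Implicit.
Unset Printing Implicit Defensive.

(** * Relational structures and first-order logic *)

Record signature := Signature { sym :> finType; ar : sym -> nat }.

(* The theorem only concerns finite structures, so structures are finite by
   definition and their relations are boolean. *)
Record structure (tau : signature) := Structure {
  carrier :> finType;
  carrier_gt0 : 0 < #|carrier|;
  interp : forall s : tau, pred ((ar s).-tuple carrier) }.

Definition homomorphism (tau : signature) (A B : structure tau) (h : A -> B) :=
  forall (s : tau) (t : (ar s).-tuple A),
    interp (s := s) t -> interp (s := s) (map_tuple h t).

Definition surjective (aT rT : Type) (h : aT -> rT) :=
  forall b, exists a, h a = b.

(* Individual variables are natural numbers. *)
Inductive formula (tau : signature) : Type :=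
| FFalse
| FEq of nat & nat
| FRel (s : tau) of (ar s).-tuple nat
| FNot of formula tau
| FAnd of formula tau & formula tau
| FOr of formula tau & formula tau
| FImp of formula tau & formula tau
| FAll of nat & formula tau
| FEx of nat & formula tau.
Arguments FFalse {tau}.
Arguments FEq {tau}.
Arguments FRel {tau}.

Definition update (T : Type) (e : nat -> T) (x : nat) (a : T) : nat -> T :=
  fun y => if y == x then a else e y.

Fixpoint sat (tau : signature) (A : structure tau) (e : nat -> A)
    (f : formula tau) : bool :=
  match f with
  | FFalse => false
  | FEq x y => e x == e y
  | FRel s xs => interp (s := s) (map_tuple e xs)
  | FNot g => ~~ sat e g
  | FAnd g h => sat e g && sat e h
  | FOr g h => sat e g || sat e h
  | FImp g h => sat e g ==> sat e h
  | FAll x g => [forall a : A, sat (update e x a) g]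
  | FEx x g => [exists a : A, sat (update e x a) g]
  end.

Fixpoint free_vars (tau : signature) (f : formula tau) : seq nat :=
  match f with
  | FFalse => [::]
  | FEq x y => [:: x; y]
  | FRel s xs => xs
  | FNot g => free_vars g
  | FAnd g h | FOr g h | FImp g h => free_vars g ++ free_vars h
  | FAll x g | FEx x g => [seq y <- free_vars g | y != x]
  end.

Fixpoint occurs (tau : signature) (s : tau) (f : formula tau) : bool :=
  match f with
  | FFalse | FEq _ _ => false
  | FRel r _ => r == s
  | FNot g | FAll _ g | FEx _ g => occurs s g
  | FAnd g h | FOr g h | FImp g h => occurs s g || occurs s h
  end.

Fixpoint conjuncts (tau : signature) (f : formula tau) : seq (formula tau) :=
  if f is FAnd g h then conjuncts g ++ conjuncts h else [:: f].

Definition foralls (tau : signature) (xs : seq nat) (f : formula tau) :=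
  foldr (@FAll tau) f xs.

(** * Extensional existential second-order logic *)

Definition sig_sum (tau Q : signature) : signature :=
  @Signature (tau + Q)%type
    (fun s => match s with inl r => ar r | inr r => ar r end).

Definition expansion (tau Q : signature) (A : structure tau)
    (I : forall R : Q, pred ((ar R).-tuple A)) : structure (sig_sum tau Q) :=
  @Structure (sig_sum tau Q) A (carrier_gt0 A)
    (fun s => match s return pred ((ar (s : sig_sum tau Q)).-tuple A) with
              | inl r => @interp tau A r
              | inr R => I R
              end).

(* The existentially quantified predicates are the symbols of [eso_quant];
   the disjoint union makes them distinct from the symbols of [tau]. *)
Record eso (tau : signature) := Eso {
  eso_quant : signature;
  eso_matrix : formula (sig_sum tau eso_quant);
  eso_closed : free_vars eso_matrix = [::] }.

(* As the matrix is closed, the assignment [e] is irrelevant. *)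
Definition models (tau : signature) (A : structure tau) (Phi : eso tau) : Prop :=
  exists I : forall R : eso_quant Phi, pred ((ar R).-tuple A),
    forall e : nat -> A, sat (A := expansion I) e (eso_matrix Phi).

(* [f] is  forall x1 ... xn, R'(x1, ..., xn) => R(x1, ..., xn)  for distinct
   variables; the equality of [xs] and [ys] as sequences forces [R'] and [R] to
   have the same arity. *)
Definition is_inclusion (tau Q : signature) (R' : tau) (R : Q)
    (f : formula (sig_sum tau Q)) : Prop :=
  exists (xs : (ar R').-tuple nat) (ys : (ar R).-tuple nat),
    [/\ uniq xs,
        xs = ys :> seq nat
      & f = foralls xs (FImp (FRel (inl R' : sig_sum tau Q) xs)
                             (FRel (inr R : sig_sum tau Q) ys))].

(* Conjuncts are compared by position, so that a repetition of the inclusion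
   counts as another occurrence of R'. *)
Definition extensional (tau : signature) (Phi : eso tau) : Prop :=
  let cs := conjuncts (eso_matrix Phi) in
  exists prime : eso_quant Phi -> tau,
    injective prime /\
    forall R : eso_quant Phi, exists2 i, i < size cs &
      is_inclusion (prime R) R (nth FFalse cs i) /\
      forall j, j < size cs -> j != i ->
        ~~ occurs (inl (prime R) : sig_sum tau _) (nth FFalse cs j).

(** * Graphs, sandwich problems and orientation completion *)

Record digraph := Digraph {
  vertex :> finType;
  vertex_gt0 : 0 < #|vertex|;
  edge : rel vertex }.

(* [oriented] excludes loops (take x = y), whereas graphs, i.e. symmetric
   relations, may have loops. *)
Definition oriented (V : Type) (e : rel V) : Prop :=
  forall x y, ~~ (e x y && e y x).

Definition embeds (H : digraph) (V : finType) (e : rel V) : Prop :=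
  exists2 f : H -> V, injective f & forall x y, e (f x) (f y) = edge x y.

(* A finite set of digraphs is given as a family indexed by a finite type. *)
Definition free_of (I : finType) (F : I -> digraph) (V : finType) (e : rel V) :
  Prop := forall i, ~ embeds (F i) e.

(* Two binary symbols: [true] is E, and [false] is N or A'. *)
Definition two_rel_sig : signature := @Signature bool (fun=> 2).

Definition two_rel_structure (V : finType) (V_gt0 : 0 < #|V|) (e1 e2 : rel V) :
    structure two_rel_sig :=
  @Structure two_rel_sig V V_gt0
    (fun b (t : 2.-tuple V) =>
       (if b then e1 else e2) (tnth t ord0) (tnth t ord_max)).

Definition sandwich_solution (I : finType) (F : I -> digraph) (V : finType)
    (E N E' : rel V) : Prop :=
  [/\ symmetric E', free_of F E', subrel E E'
    & forall x y, ~~ (E' x y && N x y)].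

Definition partially_oriented (V : finType) (E A' : rel V) : Prop :=
  [/\ symmetric E, subrel A' E & oriented A'].

Definition orientation_completion (I : finType) (F : I -> digraph) (V : finType)
    (E A' A : rel V) : Prop :=
  [/\ subrel A' A, oriented A, free_of F A
    & forall x y, E x y = A x y || A y x].

(** * Regular languages and topological sorting *)

Record dfa (Sigma : finType) := Dfa {
  state : finType;
  init : state;
  final : pred state;
  trans : state -> Sigma -> state }.

Definition accepts (Sigma : finType) (M : dfa Sigma) (w : seq Sigma) : bool :=
  final (foldl (@trans _ M) (init M) w).

Definition regular (Sigma : finType) (L : seq Sigma -> Prop) : Prop :=
  exists M : dfa Sigma, forall w, L w <-> accepts M w.

Definition syntactic_congruence (Sigma : finType) (L : seq Sigma -> Prop)
    (u v : seq Sigma) : Prop :=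
  forall x y, L (x ++ u ++ y) <-> L (x ++ v ++ y).

Definition word_pow (Sigma : finType) (v : seq Sigma) (n : nat) : seq Sigma :=
  flatten (nseq n v).

(* The syntactic monoid of L, i.e. the quotient of the free monoid by the
   syntactic congruence, is aperiodic: each of its elements m satisfies
   m^n = m^(n+1) for some n. *)
Definition aperiodic (Sigma : finType) (L : seq Sigma -> Prop) : Prop :=
  forall v, exists n, syntactic_congruence L (word_pow v n) (word_pow v n.+1).

(* [None] is the edge symbol E, [Some a] is the unary symbol of the letter a. *)
Definition letter_sig (Sigma : finType) : signature :=
  @Signature (option Sigma) (fun s => if s is Some _ then 1 else 2).

Definition labelled_structure (Sigma V : finType) (V_gt0 : 0 < #|V|)
    (E : rel V) (lab : V -> Sigma) : structure (letter_sig Sigma) :=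
  @Structure (letter_sig Sigma) V V_gt0
    (fun s => match s return pred ((ar (s : letter_sig Sigma)).-tuple V) with
              | Some a => fun t : 1.-tuple V => lab (tnth t ord0) == a
              | None => fun t : 2.-tuple V => E (tnth t ord0) (tnth t ord_max)
              end).

Definition acyclic (V : finType) (E : rel V) : Prop :=
  forall c : seq V, cycle E c -> c = [::].

Definition strict_linear_order (V : finType) (lt : rel V) : Prop :=
  [/\ irreflexive lt, transitive lt & forall x y, x != y -> lt x y || lt y x].

Definition topological_sort (V : finType) (E lt : rel V) : Prop :=
  strict_linear_order lt /\ subrel E lt.

(* [sort] expects the reflexive version of the order. *)
Definition reading (Sigma V : finType) (lt : rel V) (lab : V -> Sigma) :
    seq Sigma :=
  map lab (sort (fun x y => (x == y) || lt x y) (enum V)).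

(* Main.v *)
From HB Require Import structures.
Require Import Defs.
From mathcomp Require Import all_boot.

Set Implicit Arguments.
Unset Strict Implicit.
Unset Printing Implicit Defensive.

(** An extensional sentence sees the relation R' only through the requirement
    that the guessed relation R contains it. So a class of structures is
    expressible as soon as membership means: some relations containing the given
    ones satisfy a first-order condition in which the given ones do not occur
    ([extensional_eso]).

    Surjective CSPs: if h is a surjective homomorphism from A to B, the preimages
    of the relations of B contain the relations of A and turn A into a blow-up of
    B. That the guessed relations form such a blow-up is first-order: some
    elements, one for each element of B, induce a copy of B, and every element is
    a twin of one of them ([blowupP]).

    Sandwich and orientation problems: the edge relation of the solution is
    guessed as a superset of E, respectively of A', and the absence of finitely
    many induced subgraphs is first-order.

    Topological sorting: the order is guessed as a superset of E. It remains to
    express in first-order logic that the word read along a linear order belongs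
    to an aperiodic regular language, which is Schuetzenberger's theorem combined
    with the one of McNaughton and Papert. The proof is an induction in the style
    of Wilke, carried out on positions of a linear order instead of words:
    positions carry transformations of a finite set, letters outside the current
    alphabet are replaced by the identity, and a word is cut at all positions
    that act as a fixed nontrivial letter c. The pieces between cuts use fewer
    letters, and the sequence of the pieces acts on the image of c, which is
    smaller because c is aperiodic ([run_factor], [definable_run]). Sub-words and
    words of blocks are again labellings of the same set of positions, so
    formulas never have to be relativised or translated between alphabets. The
    aperiodic transformations come from reading a word from right to left and
    keeping the set of states from which the part read is accepted. *)

(** * First-order definability *)

Lemma eq_sat (tau : signature) (A : structure tau) (f : formula tau)
    (e e' : nat -> A) : e =1 e' -> sat e f = sat e' f.
Proof.
elim: f e e' => /= [|x y|s xs|f IHf|f IHf g IHg|f IHf g IHg|f IHf g IHg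
  |x f IHf|x f IHf] e e' eqe //.
- by rewrite !eqe.
- by congr (interp _); apply: val_inj; apply: eq_map.
- by rewrite (IHf _ _ eqe).
- by rewrite (IHf _ _ eqe) (IHg _ _ eqe).
- by rewrite (IHf _ _ eqe) (IHg _ _ eqe).
- by rewrite (IHf _ _ eqe) (IHg _ _ eqe).
- by apply: eq_forallb => a; apply: IHf => y; rewrite /update; case: ifP.
- by apply: eq_existsb => a; apply: IHf => y; rewrite /update; case: ifP.
Qed.

Lemma sat_foralls (tau : signature) (A : structure tau) (xs : seq nat)
    (f : formula tau) (e : nat -> A) :
  sat e (foralls xs f) <->
  forall e', (forall x, x \notin xs -> e' x = e x) -> sat e' f.
Proof.
elim: xs e => [|x xs IH] e /=.
  split=> [fe e' eqe | fe]; last exact: fe.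
  by rewrite (@eq_sat _ _ _ _ e) // => x; apply: eqe.
split=> [/forallP fe e' eqe | fe].
  apply: (IH _).1 (fe (e' x)) _ _ => y yxs; rewrite /update.
  by case: eqVneq => [-> //|yx]; apply: eqe; rewrite inE negb_or yx.
apply/forallP => a; apply/IH => e' eqe; apply: fe => y.
by rewrite inE negb_or => /andP[yx yxs]; rewrite eqe // /update (negPf yx).
Qed.

Lemma occurs_foralls (tau : signature) (s : tau) xs (f : formula tau) :
  occurs s (foralls xs f) = occurs s f.
Proof. by elim: xs. Qed.

Lemma free_vars_foralls (tau : signature) xs (f : formula tau) :
  free_vars (foralls xs f) = [seq y <- free_vars f | y \notin xs].
Proof.
elim: xs => [|x xs IH] /=; first by rewrite filter_predT.
by rewrite IH -filter_predI; apply: eq_filter => y /=; rewrite inE negb_or.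
Qed.

Section Definability.
Variables (Sg : signature) (ok : pred Sg) (K : pred (structure Sg)).

(** The elements of [V] are names of free variables. Asking for a formula for
    every placement [rho] of the names among the variables, injective or not,
    makes definability stable under substitution ([definable_subst]) without any
    renaming of bound variables. The formula may use the symbols in [ok] only and
    has to be correct on the structures in [K] only. *)
Definition definable (V : finType)
    (P : forall A : structure Sg, (V -> A) -> bool) : Prop :=
  forall rho : V -> nat, exists f : formula Sg,
    (forall s, occurs s f -> ok s) /\
    forall A : structure Sg, K A -> forall (e : nat -> A) (g : V -> A),
      (forall v, g v = e (rho v)) -> sat e f = P A g.

Lemma eq_definable (V : finType) (P P' : forall A : structure Sg, (V -> A) -> bool) :
  (forall A, K A -> forall g, P A g = P' A g) ->
  definable P -> definable P'.
Proof.
move=> eqP dP rho; have [f [okf fP]] := dP rho; exists f; split=> // A KA e g eg.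
by rewrite (fP A KA e g eg) eqP.
Qed.

Lemma definable_subst (V W : finType) (sigma : V -> W)
    (P : forall A : structure Sg, (V -> A) -> bool) :
  definable P -> definable (fun A (g : W -> A) => P A (fun v => g (sigma v))).
Proof.
move=> dP rho; have [f [okf fP]] := dP (fun v => rho (sigma v)).
by exists f; split=> // A KA e g eg; apply: fP.
Qed.

Section Connectives.
Variable V : finType.
Implicit Types P : forall A : structure Sg, (V -> A) -> bool.

Lemma definable_neg P : definable P -> definable (fun A g => ~~ P A g).
Proof.
move=> dP rho; have [f [okf fP]] := dP rho; exists (FNot f); split=> // A KA e g eg.
by rewrite /= (fP A KA e g eg).
Qed.

Lemma definable_and P P' :
  definable P -> definable P' -> definable (fun A g => P A g && P' A g).
Proof.
move=> dP dP' rho; have [f [okf fP]] := dP rho; have [f' [okf' fP']] := dP' rho.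
exists (FAnd f f'); split=> [s /orP[/okf|/okf'] //|A KA e g eg].
by rewrite /= (fP A KA e g eg) (fP' A KA e g eg).
Qed.

Lemma definable_or P P' :
  definable P -> definable P' -> definable (fun A g => P A g || P' A g).
Proof.
move=> dP dP'; apply: eq_definable (fun A g => ~~ (~~ P A g && ~~ P' A g)) _ _ _.
  by move=> A _ g; rewrite negb_and !negbK.
by apply/definable_neg/definable_and; apply: definable_neg.
Qed.

Lemma definable_imp P P' :
  definable P -> definable P' -> definable (fun A g => P A g ==> P' A g).
Proof.
move=> dP dP'; apply: eq_definable (fun A g => ~~ P A g || P' A g) _ _ _.
  by move=> A _ g; rewrite implybE.
by apply: definable_or => //; apply: definable_neg.
Qed.

Lemma definable_if P P1 P2 : definable P -> definable P1 -> definable P2 ->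
  definable (fun A g => if P A g then P1 A g else P2 A g).
Proof.
move=> dP dP1 dP2; apply: eq_definable
  (fun A g => (P A g ==> P1 A g) && (~~ P A g ==> P2 A g)) _ _ _.
  by move=> A _ g; case: (P A g); rewrite /= ?andbT.
apply: definable_and; apply: definable_imp => //.
exact: definable_neg.
Qed.

Lemma definable_iff P P' :
  definable P -> definable P' -> definable (fun A g => P A g == P' A g).
Proof.
move=> dP dP'.
apply: eq_definable (fun A g => if P A g then P' A g else ~~ P' A g) _ _ _.
  by move=> A _ g; case: (P A g); case: (P' A g).
by apply: definable_if => //; apply: definable_neg.
Qed.

Lemma definable_const (b : bool) : definable (fun A (g : V -> A) => b).
Proof.
by move=> rho; case: b; [exists (FNot FFalse)|exists FFalse].
Qed.

Lemma definable_eq (v w : V) : definable (fun A g => g v == g w).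
Proof.
by move=> rho; exists (FEq (rho v) (rho w)); split=> // A KA e g eg; rewrite /= !eg.
Qed.

(** The tuple [T] is compared to the image of [t] as a sequence, because
    literal tuples such as [[tuple g v; g w]] carry another proof of their size
    than mapped tuples. *)
Lemma definable_rel (s : Sg) (t : (ar s).-tuple V)
    (T : forall A : structure Sg, (V -> A) -> (ar s).-tuple A) :
  ok s -> (forall (A : structure Sg) (g : V -> A), T A g = map g t :> seq A) ->
  definable (fun A g => interp (T A g)).
Proof.
move=> oks eqT rho; exists (FRel s (map_tuple rho t)).
split=> [r /eqP <- //|A KA e g eg] /=; congr (interp _); apply: val_inj.
by rewrite /= eqT -map_comp; apply: eq_map => v /=; rewrite eg.
Qed.

Lemma definable_bigand (I : finType)
    (P : I -> forall A : structure Sg, (V -> A) -> bool) :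
  (forall i, definable (P i)) -> definable (fun A g => [forall i, P i A g]).
Proof.
move=> dP; apply: eq_definable (fun A g => all (fun i => P i A g) (enum I)) _ _ _.
  move=> A _ g; apply/allP/forallP => [h i|h i _ //].
  by apply: h; rewrite mem_enum.
elim: (enum I) => [|i r IH]; first exact: definable_const.
exact: definable_and.
Qed.

Lemma definable_bigor (I : finType)
    (P : I -> forall A : structure Sg, (V -> A) -> bool) :
  (forall i, definable (P i)) -> definable (fun A g => [exists i, P i A g]).
Proof.
move=> dP; apply: eq_definable (fun A g => ~~ [forall i, ~~ P i A g]) _ _ _.
  by move=> A _ g; rewrite negb_forall; apply: eq_existsb => i; rewrite negbK.
by apply/definable_neg/definable_bigand => i; apply: definable_neg.
Qed.

End Connectives.

Section Quantifiers.
Variable V : finType.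

(** A block of quantifiers, one for each name in [W], placed on variables above
    all those used for [V]. *)
Lemma definable_forall_fun (W : finType)
    (P : forall A : structure Sg, (V -> A) -> (W -> A) -> bool) :
  definable (fun A (g : V + W -> A) =>
    P A (fun v => g (inl v)) (fun w => g (inr w))) ->
  definable (fun A g => [forall h : {ffun W -> A}, P A g h]).
Proof.
move=> dP rho; pose N := (\max_v rho v).+1.
have rhoN v : rho v < N by rewrite ltnS leq_bigmax.
have [f [okf fP]] := dP (fun s => match s with
  inl v => rho v | inr w => N + enum_rank w end).
exists (foralls (iota N #|W|) f); split=> [s|A KA e g eg].
  by rewrite occurs_foralls; apply: okf.
apply/idP/forallP => [/sat_foralls fe h|Ph].
  pose e' k := if k < N then e k else
    if insub (k - N) is Some i then h (enum_val (i : 'I_#|W|)) else e k.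
  have e'N x : x \notin iota N #|W| -> e' x = e x.
    rewrite mem_iota negb_and -ltnNge -leqNgt /e'.
    case: ltnP => //= Nx NWx; rewrite insubF //.
    by apply/negbTE; rewrite -leqNgt leq_subRL.
  pose g' s := match s with inl v => g v | inr w => h w end.
  rewrite -(fP A KA e' g') ?fe // => -[v|w] /=; rewrite /e'.
    by rewrite rhoN eg.
  by rewrite ltnNge leq_addr addKn /= valK enum_rankK.
apply/sat_foralls => e' e'N.
pose h := [ffun w : W => e' (N + enum_rank w)].
pose g' s := match s with inl v => g v | inr w => h w end.
rewrite (fP A KA e' g') ?Ph // => -[v|w] /=; last by rewrite ffunE.
by rewrite e'N // mem_iota leqNgt rhoN.
Qed.

Lemma definable_exists_fun (W : finType)
    (P : forall A : structure Sg, (V -> A) -> (W -> A) -> bool) :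
  definable (fun A (g : V + W -> A) =>
    P A (fun v => g (inl v)) (fun w => g (inr w))) ->
  definable (fun A g => [exists h : {ffun W -> A}, P A g h]).
Proof.
move=> dP; apply: eq_definable
  (fun A g => ~~ [forall h : {ffun W -> A}, ~~ P A g h]) _ _ _.
  by move=> A _ g; rewrite negb_forall; apply: eq_existsb => i; rewrite negbK.
apply: definable_neg; apply: (definable_forall_fun (P := fun A g h => ~~ P A g h)).
exact: definable_neg.
Qed.

Lemma definable_forall (P : forall A : structure Sg, (V -> A) -> A -> bool) :
  definable (fun A (g : option V -> A) => P A (fun v => g (Some v)) (g None)) ->
  definable (fun A g => [forall a, P A g a]).
Proof.
move=> dP; apply: eq_definable
  (fun A g => [forall h : {ffun unit -> A}, P A g (h tt)]) _ _ _.
  move=> A _ g; apply/forallP/forallP => Pg a; last exact: Pg.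
  by have := Pg [ffun=> a]; rewrite ffunE.
apply: (definable_forall_fun (P := fun A g h => P A g (h tt))).
exact: (definable_subst (fun o => if o is Some v then inl v else inr tt) dP).
Qed.

Lemma definable_exists (P : forall A : structure Sg, (V -> A) -> A -> bool) :
  definable (fun A (g : option V -> A) => P A (fun v => g (Some v)) (g None)) ->
  definable (fun A g => [exists a, P A g a]).
Proof.
move=> dP; apply: eq_definable (fun A g => ~~ [forall a, ~~ P A g a]) _ _ _.
  by move=> A _ g; rewrite negb_forall; apply: eq_existsb => i; rewrite negbK.
apply: definable_neg; apply: (definable_forall (P := fun A g a => ~~ P A g a)).
exact: definable_neg.
Qed.

End Quantifiers.
End Definability.

(** Definability relative to a definable class [K] becomes absolute in
    conjunction with [K]; this serves for properties of linear orders. *)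
Lemma definable_and_promise (Sg : signature) (ok : pred Sg)
    (K : pred (structure Sg)) (V : finType)
    (P : forall A : structure Sg, (V -> A) -> bool) :
  definable ok predT (fun A (g : V -> A) => K A) -> definable ok K P ->
  definable ok predT (fun A g => K A && P A g).
Proof.
move=> dK dP rho; have [k [okk kK]] := dK rho; have [f [okf fP]] := dP rho.
exists (FAnd k f); split=> [s /orP[/okk|/okf] //|A _ e g eg].
rewrite /= (kK A isT e g eg); case: (boolP (K A)) => // KA.
exact: fP A KA e g eg.
Qed.

(** * Extensional sentences from definable properties *)

(** The quantified symbols are indexed by [T], and [prime] sends each to the
    given symbol that it extends; copying the arity avoids casts. *)
Definition quantified (tau : signature) (T : finType) (prime : T -> tau) :
  signature := @Signature T (fun R => ar (prime R)).

Definition unprimed (tau : signature) (T : finType) (prime : T -> tau) :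
    pred (sig_sum tau (quantified prime)) :=
  fun s => if s is inl r then r \notin codom prime else true.


Section Package.
Variables (tau : signature) (T : finType) (prime : T -> tau).
Let Sg := sig_sum tau (quantified prime).

Definition inclusion (R : T) : formula Sg :=
  let xs := iota_tuple (ar (prime R)) 0 in
  foralls xs (FImp (FRel (inl (prime R) : Sg) xs) (FRel (inr R : Sg) xs)).

Lemma is_inclusion_inclusion (R : T) :
  @is_inclusion tau (quantified prime) (prime R) R (inclusion R).
Proof.
exists (iota_tuple (ar (prime R)) 0), (iota_tuple (ar (prime R)) 0).
by split=> //=; apply: iota_uniq.
Qed.

Lemma sat_inclusion (A : structure tau)
    (I : forall R : quantified prime, pred ((ar R).-tuple A)) (R : T) e :
  sat (A := expansion I) e (inclusion R) <->
  forall t, interp (s := prime R) t -> I R t.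
Proof.
apply: iff_trans (sat_foralls _ _ _) _; split=> /= [incl t Rt|incl e' _]; last first.
  by apply/implyP; apply: incl.
pose e' k := if k < ar (prime R) then nth (e 0) t k else e k.
have e't : map_tuple e' (iota_tuple (ar (prime R)) 0) = t.
  apply: val_inj => /=; apply: (@eq_from_nth _ (e 0)).
    by rewrite size_map size_iota size_tuple.
  rewrite size_map size_iota => i lti.
  by rewrite (nth_map 0) ?size_iota // nth_iota // /e' add0n lti.
suff /incl : forall x, x \notin iota 0 (ar (prime R)) -> e' x = e x.
  by rewrite e't => /implyP; apply.
by move=> x; rewrite mem_iota /= add0n /e' => /negbTE ->.
Qed.

(** The matrix is the conjunction of the inclusions with the universal closure of
    a formula for [P]. The closure makes the matrix closed and, as [P] does not
    depend on an assignment, does not change its meaning. *)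
Lemma extensional_eso (P : structure Sg -> bool) :
  injective prime ->
  definable (unprimed (prime := prime)) predT (fun A (_ : void -> A) => P A) ->
  exists Phi : eso tau, extensional Phi /\
    forall A : structure tau, models A Phi <->
      exists I : forall R : quantified prime, pred ((ar R).-tuple A),
        (forall R t, interp (s := prime R) t -> I R t) /\ P (expansion I).
Proof.
move=> inj_prime /(_ (fun v : void => match v with end))[f [okf fP]].
pose main := foralls (free_vars f) f.
pose matrix := foldr (@FAnd Sg) main (map inclusion (enum T)).
have closed_matrix : free_vars matrix = [::].
  rewrite /matrix; elim: (enum T) => [|R r IH] /=.
    rewrite free_vars_foralls; apply/eqP; rewrite -[_ == _]negbK -has_filter.
    by apply/hasPn => x ->.
  rewrite IH cats0 free_vars_foralls /=; apply/eqP.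
  rewrite -[_ == _]negbK -has_filter; apply/hasPn => x.
  by rewrite mem_cat orbb => ->.
have cjE : conjuncts matrix = map inclusion (enum T) ++ conjuncts main.
  rewrite /matrix; elim: (enum T) => [|R r IH] //=; rewrite IH.
  by rewrite /inclusion /=; case: (iota 0 _).
have occ_main R : ~~ occurs (inl (prime R) : Sg) main.
  apply/negP; rewrite occurs_foralls => /okf.
  by rewrite /unprimed codom_f.
have has_conj (s : Sg) (h : formula Sg) : has (occurs s) (conjuncts h) = occurs s h.
  elim: h => /= *; rewrite ?orbF //.
  by rewrite has_cat; congr (_ || _).
exists (Eso closed_matrix); split.
  exists prime; split=> // R; exists (index R (enum T)).
    by rewrite cjE size_cat size_map ltn_addr // index_mem mem_enum.
  rewrite /= cjE nth_cat size_map index_mem mem_enum /=.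
  rewrite (nth_map R) ?index_mem ?mem_enum // nth_index ?mem_enum //.
  split=> [|j ltj neqj]; first exact: is_inclusion_inclusion.
  rewrite nth_cat size_map; case: ltnP => lej.
    rewrite (nth_map R) // occurs_foralls /= orbF; apply: contra neqj.
    by move=> /eqP[/inj_prime <-]; rewrite index_uniq // enum_uniq.
  apply: contraNN _ (occ_main R) => occ; rewrite -has_conj; apply/(has_nthP FFalse).
  exists (j - size (enum T)) => //.
  by rewrite ltn_subLR // -(size_map inclusion) -size_cat.
move=> A.
have satE (I : forall R : quantified prime, pred ((ar R).-tuple A)) (e : nat -> A) :
    sat (A := expansion I) e matrix <->
    (forall R t, interp (s := prime R) t -> I R t) /\ P (expansion I).
  have mainE : sat (A := expansion I) e main <-> P (expansion I).
    have fE (e' : nat -> expansion I) : sat e' f = P (expansion I).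
      by rewrite (fP (expansion I) isT e' (fun v : void => match v with end)) //; case.
    apply: iff_trans (sat_foralls _ _ _) _; split.
      by move=> /(_ e (fun _ _ => erefl)); rewrite fE.
    by move=> h e' _; rewrite fE.
  have inclE R := @sat_inclusion A I R e.
  rewrite /matrix; split=> [h|[hI /mainE hm]].
    have [hI hm] : {in enum T, forall R, sat (A := expansion I) e (inclusion R)} /\
                   sat (A := expansion I) e main.
      move: h; elim: (enum T) => [|R r IH] //= /andP[hR /IH[hr hm]].
      by split=> // R'; rewrite inE => /predU1P[->|/hr].
    by split; [move=> R; apply/inclE/hI; rewrite mem_enum|apply/mainE].
  elim: (enum T) => [|R r IH] //=; apply/andP; split=> //.
  exact/inclE/hI.
have /card_gt0P[a0 _] := carrier_gt0 A.
split=> [[I hI]|[I hI]]; exists I; first exact: (satE I (fun=> a0)).1.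
by move=> e; apply/satE.
Qed.
End Package.

(** * Surjective homomorphisms *)

Section Blowup.
Variables (tau : signature) (B : structure tau).

Section Semantics.
Variables (A : finType) (J : forall s : tau, pred ((ar s).-tuple A)).

(** Exchanging [y] and [x] at a single place of a tuple never matters. *)
Definition twin (y x : A) : bool :=
  [forall s : tau, forall i : 'I_(ar s), forall z : {ffun 'I_(ar s) -> A},
    J [tuple if j == i then y else z j | j < ar s] ==
    J [tuple if j == i then x else z j | j < ar s]].

(** The elements [x b] induce a copy of [B], and all elements are twins of
    them. *)
Definition blowup : bool :=
  [exists x : {ffun B -> A},
    [&& [forall b, forall c, (x b == x c) ==> (b == c)],
        [forall s : tau, forall t : (ar s).-tuple B,
          J (map_tuple x t) == interp t]
      & [forall y, exists b, twin y (x b)]]].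

(** The coordinates are replaced one after the other. *)
Lemma twin_replace (k : A -> A) (s : tau) (t : (ar s).-tuple A) :
  (forall y, twin y (k y)) -> J t = J (map_tuple k t).
Proof.
move=> twk.
have step m : J t = J [tuple if j < m then k (tnth t j) else tnth t j | j < ar s].
  elim: m => [|m ->].
    by congr (J _); apply: eq_from_tnth => j; rewrite tnth_mktuple.
  case: (ltnP m (ar s)) => [ltm|lem]; last first.
    congr (J _); apply: eq_from_tnth => j; rewrite !tnth_mktuple.
    by rewrite ltnS (leq_trans (ltn_ord j) lem) (ltnW (leq_trans (ltn_ord j) lem)).
  pose i := Ordinal ltm.
  pose z := [ffun j : 'I_(ar s) => if j < m then k (tnth t j) else tnth t j].
  have /forallP/(_ s)/forallP/(_ i)/forallP/(_ z)/eqP := twk (tnth t i).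
  move=> Jz; apply: etrans (etrans _ Jz) _; congr (J _);
    apply: eq_from_tnth => j; rewrite !tnth_mktuple ffunE.
    by case: eqVneq => // ->; rewrite ltnn.
  case: eqVneq => [->|neqj]; first by rewrite ltnSn.
  by rewrite ltnS [j <= m]leq_eqVlt [j == m :> nat](negPf neqj).
rewrite (step (ar s)); congr (J _); apply: eq_from_tnth => j.
by rewrite tnth_mktuple ltn_ord tnth_map.
Qed.

(** In one direction, [h] sends every element to some [b] with twin [x b]; since
    distinct elements of [B] may be twins, [x b] itself has to be sent to [b] for
    [h] to be surjective. In the other direction, [x] is a section of [h]. *)
Lemma blowupP : blowup <->
  exists2 h : A -> B, surjective h &
    forall (s : tau) (t : (ar s).-tuple A), J t = interp (map_tuple h t).
Proof.
split=> [/existsP[x /and3P[/forallP injx /forallP xJ /forallP twx]]|[h surjh hJ]].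
  have x_inj b c : x b = x c -> b = c.
    by move=> xbc; have /forallP/(_ c)/implyP := injx b; rewrite xbc => /(_ _)/eqP; apply.
  have /fin_all_exists[h hP] y : exists b, twin y (x b) /\ forall c, y = x c -> b = c.
    case: (pickP (fun c => y == x c)) => [c /eqP ->|noc].
      exists c; split=> [|d /x_inj //].
      by apply/forallP=> s; apply/forallP => i; apply/forallP.
    have /existsP[b twb] := twx y; exists b; split=> // c /eqP.
    by rewrite noc.
  exists h => [b|s t]; first by exists (x b); apply: (hP (x b)).2.
  have /forallP/(_ (map_tuple h t))/eqP <- := xJ s.
  rewrite (@twin_replace (x \o h)); last by move=> y; apply: (hP y).1.
  by congr (J _); apply: val_inj; rewrite /= map_comp.
have /fin_all_exists[x hx] := surjh.
apply/existsP; exists (finfun x); apply/and3P; split.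
- apply/forallP => b; apply/forallP => c; apply/implyP => /eqP.
  by rewrite !ffunE => xbc; rewrite -(hx b) xbc hx.
- apply/forallP => s; apply/forallP => t; rewrite hJ; apply/eqP; congr (interp _).
  apply: eq_from_tnth => i; rewrite !tnth_map.
  by rewrite ffunE hx.
apply/forallP => y; apply/existsP; exists (h y); apply/forallP => s.
apply/forallP => i; apply/forallP => z; rewrite !hJ; apply/eqP; congr (interp _).
apply: eq_from_tnth => j; rewrite !tnth_map !tnth_ord_tuple.
by case: eqP => // _; rewrite ffunE hx.
Qed.
End Semantics.

Let Sg := sig_sum tau (quantified (@id tau)).

Lemma definable_blowup :
  definable (unprimed (prime := @id tau)) predT
    (fun A (_ : void -> A) => blowup (fun s => @interp Sg A (inr s))).
Proof.
apply: (definable_exists_fun (P := fun (A : structure Sg) (g : void -> A) x =>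
  [&& [forall b, forall c, (x b == x c) ==> (b == c)],
      [forall s : tau, forall t : (ar s).-tuple B,
        @interp Sg A (inr s) (map_tuple x t) == interp t]
    & [forall y, exists b, twin (fun s => @interp Sg A (inr s)) y (x b)]])).
apply: definable_and; [|apply: definable_and].
- apply: definable_bigand => b; apply: definable_bigand => c.
  by apply: definable_imp; [apply: definable_eq|apply: definable_const].
- apply: definable_bigand => s; apply: definable_bigand => t.
  apply: definable_iff; last exact: definable_const.
  apply: (@definable_rel Sg _ _ _ (inr s) (map_tuple inr t)) => // A g /=.
  by rewrite -map_comp.
apply: (definable_forall (P := fun A g y =>
  [exists b, twin (fun s => @interp Sg A (inr s)) y (g (inr b))])).
apply: definable_bigor => b.
apply: definable_bigand => s; apply: definable_bigand => i.
pose zt o : (ar s).-tuple (option (void + B) + 'I_(ar s)) :=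
  [tuple if j == i then inl o else inr j | j < ar s].
apply: (definable_forall_fun (P := fun A g z =>
  @interp Sg A (inr s) [tuple if j == i then g None else z j | j < ar s] ==
  @interp Sg A (inr s)
    [tuple if j == i then g (Some (inr b)) else z j | j < ar s])).
have defz o : definable (unprimed (prime := @id tau)) predT
    (fun A (g : option (void + B) + 'I_(ar s) -> A) => @interp Sg A (inr s)
       [tuple if j == i then g (inl o) else g (inr j) | j < ar s]).
  apply: (@definable_rel Sg _ _ _ (inr s) (zt o)) => // A g.
  rewrite /= -map_comp; apply: eq_map => j /=.
  by case: ifP.
by apply: definable_iff; apply: defz.
Qed.

(** All symbols are extended; the guessed relations are the preimages of the
    relations of [B]. *)
Lemma surjective_homomorphism_eso :
  exists Phi : eso tau, extensional Phi /\
    forall A : structure tau, models A Phi <->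
      exists h : A -> B, homomorphism h /\ surjective h.
Proof.
have [Phi [extPhi PhiP]] := extensional_eso (fun _ _ => id) definable_blowup.
exists Phi; split=> // A; apply: iff_trans (PhiP A) _; split.
  case=> I [subI /blowupP[h surjh hI]]; exists h; split=> // s t ts.
  by have := subI s t ts; have /= -> := hI s t.
case=> h [homh surjh].
exists (fun s (t : (ar s).-tuple A) => interp (s := s) (map_tuple h t)).
split; first by move=> s t; apply: homh.
by apply/blowupP; exists h.
Qed.
End Blowup.

(** * Sandwich problems and orientation completion *)

Section DefinableRelations.
Variables (Sg : signature) (ok : pred Sg) (K : pred (structure Sg)).

Definition definable_relation (r : forall A : structure Sg, rel A) : Prop :=
  forall (V : finType) (v w : V), definable ok K (fun A (g : V -> A) => r A (g v) (g w)).

Lemma definable_forall2 (V : finType) (P : forall A : structure Sg, A -> A -> bool) :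
  definable ok K (fun A (g : option (option V) -> A) => P A (g (Some None)) (g None)) ->
  definable ok K (fun A (_ : V -> A) => [forall x, forall y, P A x y]).
Proof.
move=> dP; apply: (definable_forall (P := fun A _ x => [forall y, P A x y])).
exact: (definable_forall (P := fun (A : structure Sg) (g : option V -> A) y =>
  P A (g None) y)).
Qed.

Variables (I : finType) (F : I -> digraph).

(** The definition [free_of] as a boolean, in the shape of its formula. *)
Definition free_ofb (V : finType) (e : rel V) : bool :=
  [forall i, ~~ [exists f : {ffun F i -> V},
    [forall x, forall y, (f x == f y) ==> (x == y)] &&
    [forall x, forall y, e (f x) (f y) == edge x y]]].

Lemma free_ofP (V : finType) (e : rel V) : free_ofb e <-> free_of F e.
Proof.
split=> [/forallP frF i [f injf ef]|frF].
  have /existsP := frF i; apply; exists (finfun f); apply/andP; split.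
    apply/forallP => x; apply/forallP => y; apply/implyP; rewrite !ffunE.
    by move=> /eqP/injf ->.
  by apply/forallP => x; apply/forallP => y; rewrite !ffunE ef.
apply/forallP => i; apply/existsP => -[f /andP[/forallP injf /forallP ef]].
apply: (frF i); exists f => [x y fxy|x y]; last by apply/eqP/(forallP (ef x)).
by have /forallP/(_ y)/implyP := injf x; rewrite fxy => /(_ _)/eqP; apply.
Qed.

Lemma definable_free_ofb (V : finType) (r : forall A : structure Sg, rel A) :
  definable_relation r ->
  definable ok K (fun A (_ : V -> A) => free_ofb (r A)).
Proof.
move=> dr; apply: definable_bigand => i; apply: definable_neg.
apply: (definable_exists_fun (P := fun (A : structure Sg) (_ : V -> A) (f : F i -> A) =>
    [forall x, forall y, (f x == f y) ==> (x == y)] &&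
    [forall x, forall y, r A (f x) (f y) == edge x y])).
apply: definable_and; apply: definable_bigand => x; apply: definable_bigand => y.
  by apply: definable_imp; [apply: definable_eq|apply: definable_const].
by apply: definable_iff; [apply: dr|apply: definable_const].
Qed.
End DefinableRelations.

Section GraphProblems.
Variable b : two_rel_sig.
Let prime (_ : unit) : two_rel_sig := b.
Let Sg := sig_sum two_rel_sig (quantified prime).

Definition given (c : two_rel_sig) (A : structure Sg) : rel A :=
  fun x y => @interp Sg A (inl c) [tuple x; y].
Definition guessed (A : structure Sg) : rel A :=
  fun x y => @interp Sg A (inr tt) [tuple x; y].
Arguments given c A x y : clear implicits.
Arguments guessed A x y : clear implicits.

Lemma definable_guessed : definable_relation (unprimed (prime := prime)) predT guessed.
Proof.
by move=> V v w; apply: (@definable_rel Sg _ _ _ (inr tt) [tuple v; w]).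
Qed.

Lemma definable_given c : c != b ->
  definable_relation (unprimed (prime := prime)) predT (given c).
Proof.
move=> cb V v w; apply: (@definable_rel Sg _ _ _ (inl c) [tuple v; w]) => //.
by apply/codomP => -[u cE]; rewrite cE eqxx in cb.
Qed.

(** The symbol [b] is the one whose superset is guessed, so the condition [P] on
    the guessed relation may only mention the other symbol, [~~ b]. *)
Lemma graph_eso (P : forall V : finType, rel V -> rel V -> bool) :
  definable (unprimed (prime := prime)) predT
    (fun A (_ : void -> A) => P A (given (~~ b) A) (guessed A)) ->
  exists Phi : eso two_rel_sig, extensional Phi /\
    forall (V : finType) (V_gt0 : 0 < #|V|) (e1 e2 : rel V),
      models (two_rel_structure V_gt0 e1 e2) Phi <->
      exists e : rel V, subrel (if b then e1 else e2) e /\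
                        P V (if ~~ b then e1 else e2) e.
Proof.
move=> dP; have prime_inj : injective prime by case=> -[].
have [Phi [extPhi PhiP]] := extensional_eso prime_inj dP.
exists Phi; split=> // V V_gt0 e1 e2; apply: iff_trans (PhiP _) _; split.
  case=> J [subJ PJ]; exists (fun x y => J tt [tuple x; y]); split=> // x y exy.
  exact: (subJ tt [tuple x; y]).
case=> e [sub_e Pe]; exists (fun _ t => e (tnth t ord0) (tnth t ord_max)).
by split=> // R t; apply: sub_e.
Qed.

End GraphProblems.
Arguments given b c A x y : clear implicits.
Arguments guessed b A x y : clear implicits.

Lemma sandwich_eso (I : finType) (F : I -> digraph) :
  exists Phi : eso two_rel_sig, extensional Phi /\
    forall (V : finType) (V_gt0 : 0 < #|V|) (E N : rel V),
      models (two_rel_structure V_gt0 E N) Phi <->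
      exists E' : rel V, sandwich_solution F E N E'.
Proof.
have [|Phi [extPhi PhiP]] := @graph_eso true (fun V N E' =>
  [&& [forall x, forall y, E' x y == E' y x], free_ofb F E'
    & [forall x, forall y, ~~ (E' x y && N x y)]]).
  apply: definable_and; [|apply: definable_and].
  - apply: (definable_forall2 (P := fun A x y =>
      guessed true A x y == guessed true A y x)).
    by apply: definable_iff; apply: definable_guessed.
  - exact/definable_free_ofb/definable_guessed.
  apply: (definable_forall2 (P := fun A x y =>
    ~~ (guessed true A x y && given true false A x y))).
  apply: definable_neg; apply: definable_and; first exact: definable_guessed.
  exact: definable_given.
exists Phi; split=> // V V_gt0 E N; apply: iff_trans (PhiP _ _ _ _) _.
split=> -[E'].
  case=> EE' /and3P[/forallP symE' /free_ofP frE' /forallP NE'].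
  exists E'; split=> // x y; first by apply/eqP/(forallP (symE' x)).
  exact: (forallP (NE' x)).
case=> symE' /free_ofP frE' EE' NE'; exists E'; split=> //; apply/and3P; split=> //.
  by apply/forallP => x; apply/forallP => y; rewrite symE'.
by apply/forallP => x; apply/forallP => y.
Qed.

Lemma orientation_completion_eso (I : finType) (F : I -> digraph) :
  exists Phi : eso two_rel_sig, extensional Phi /\
    forall (V : finType) (V_gt0 : 0 < #|V|) (E A' : rel V),
      models (two_rel_structure V_gt0 E A') Phi <->
      exists A : rel V, orientation_completion F E A' A.
Proof.
have [|Phi [extPhi PhiP]] := @graph_eso false (fun V E A =>
  [&& [forall x, forall y, ~~ (A x y && A y x)], free_ofb F A
    & [forall x, forall y, E x y == A x y || A y x]]).
  apply: definable_and; [|apply: definable_and].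
  - apply: (definable_forall2 (P := fun A x y =>
      ~~ (guessed false A x y && guessed false A y x))).
    by apply: definable_neg; apply: definable_and; apply: definable_guessed.
  - exact/definable_free_ofb/definable_guessed.
  apply: (definable_forall2 (P := fun A x y =>
    given false true A x y == guessed false A x y || guessed false A y x)).
  apply: definable_iff; first exact: definable_given.
  by apply: definable_or; apply: definable_guessed.
exists Phi; split=> // V V_gt0 E A'; apply: iff_trans (PhiP _ _ _ _) _.
split=> -[A].
  case=> A'A /and3P[/forallP orA /free_ofP frA /forallP EA].
  exists A; split=> // x y; first exact: (forallP (orA x)).
  by apply/eqP/(forallP (EA x)).
case=> A'A orA /free_ofP frA EA; exists A; split=> //; apply/and3P; split=> //.
  by apply/forallP => x; apply/forallP => y; apply: orA.
by apply/forallP => x; apply/forallP => y; rewrite /= EA.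
Qed.

(** * Words of transformations along a linear order *)

Section Transformations.
Variable Q : finType.

(** Transformations compose as functions, so the last letter of a word acts
    first: [run] reads words from right to left. *)
Definition comp (f g : {ffun Q -> Q}) : {ffun Q -> Q} := [ffun q => f (g q)].
Definition idt : {ffun Q -> Q} := [ffun q => q].

Lemma comp_assoc : associative comp.
Proof. by move=> f g h; apply/ffunP => q; rewrite !ffunE. Qed.
Lemma comp_idl : left_id idt comp.
Proof. by move=> f; apply/ffunP => q; rewrite !ffunE. Qed.
Lemma comp_idr : right_id idt comp.
Proof. by move=> f; apply/ffunP => q; rewrite !ffunE. Qed.

HB.instance Definition _ :=
  Monoid.isLaw.Build {ffun Q -> Q} idt comp comp_assoc comp_idl comp_idr.

Lemma compE f g q : comp f g q = f (g q).
Proof. by rewrite ffunE. Qed.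

Lemma idtE q : idt q = q.
Proof. by rewrite ffunE. Qed.

Definition run (A : Type) (lab : A -> {ffun Q -> Q}) (s : seq A) :=
  \big[comp/idt]_(x <- s) lab x.

Lemma run_cat (A : Type) (lab : A -> {ffun Q -> Q}) s t q :
  run lab (s ++ t) q = run lab s (run lab t q).
Proof. by rewrite /run big_cat compE. Qed.

Lemma run_cons (A : Type) (lab : A -> {ffun Q -> Q}) x t q :
  run lab (x :: t) q = lab x (run lab t q).
Proof. by rewrite /run big_cons compE. Qed.

Lemma run_idt (A : eqType) (lab : A -> {ffun Q -> Q}) s :
  {in s, forall x, lab x = idt} -> run lab s = idt.
Proof. by move=> lab1; rewrite /run big1_seq // => x /andP[_ /lab1]. Qed.

Lemma run_stable (A : Type) (lab : A -> {ffun Q -> Q}) (X : {set Q}) s :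
  (forall x q, q \in X -> lab x q \in X) -> forall q, q \in X -> run lab s q \in X.
Proof.
move=> labX q qX; elim: s => [|x s IH]; first by rewrite /run big_nil idtE.
by rewrite run_cons labX.
Qed.

Section Factorisation.
Variables (A : finType) (lt : rel A) (s : seq A).
Hypotheses (lt_strict : strict_linear_order lt) (sorted_s : pairwise lt s).
Hypothesis mem_s : forall x, x \in s.
Variables (lab : A -> {ffun Q -> Q}) (cut : pred A).

(** Positions outside of [C] are made to act as the identity, which amounts to
    deleting them from the word while keeping the set of positions. *)
Definition keep (C : pred A) (x : A) : {ffun Q -> Q} := if C x then lab x else idt.

Definition before_cuts (x : A) := [forall y, cut y ==> lt x y].
Definition after_cuts (x : A) := [forall y, cut y ==> lt y x].
Definition next_block (x z : A) := lt x z && [forall y, cut y && lt x y ==> lt z y].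
Definition has_next (x : A) := [exists y, cut y && lt x y].

(** A cut that is not the last one stands for itself together with the block up
    to the next cut; all other positions are neutral. *)
Definition block_lab (c : {ffun Q -> Q}) (x : A) : {ffun Q -> Q} :=
  if cut x && has_next x then comp c (run (keep (next_block x)) s) else idt.

Let lt_irr x : lt x x = false. Proof. by have [-> _ _] := lt_strict. Qed.

Let lt_asym x y : lt x y -> lt y x = false.
Proof.
have [irr tr _] := lt_strict; move=> xy; apply/negP => yx.
by have := tr _ _ _ xy yx; rewrite irr.
Qed.

Let sides p y t : s = p ++ y :: t ->
  [/\ {in p, forall x, lt x y}, {in t, forall x, lt y x}
    & forall x, [|| x \in p, x == y | x \in t]].
Proof.
move=> sE; move: sorted_s; rewrite sE pairwise_cat /=.
case/and3P=> /allrelP pyt _ /andP[/allP yt _]; split=> //.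
  by move=> x xp; apply: pyt => //; apply: mem_head.
by move=> x; have := mem_s x; rewrite sE mem_cat inE.
Qed.

Lemma run_keep p t u C : s = p ++ t ++ u ->
  {in p, forall x, ~~ C x} -> {in t, forall x, C x} -> {in u, forall x, ~~ C x} ->
  run (keep C) s = run lab t.
Proof.
move=> -> pC tC uC; apply/ffunP => q; rewrite !run_cat.
rewrite [run _ u]run_idt => [|x /uC/negbTE]; last by rewrite /keep => ->.
rewrite [run _ p]run_idt => [|x /pC/negbTE]; last by rewrite /keep => ->.
rewrite !idtE (_ : run (keep C) t = run lab t) //; apply: eq_big_seq => x /tC.
by rewrite /keep => ->.
Qed.

Lemma run_no_cut : ~~ [exists y, cut y] -> run (keep before_cuts) s = run lab s.
Proof.
rewrite negb_exists => /forallP nocut.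
apply: (@run_keep [::] s [::]); rewrite ?cats0 // => x _.
by apply/forallP => y; rewrite (negPf (nocut y)).
Qed.

Variables (X : {set Q}) (c : {ffun Q -> Q}).
Hypothesis lab_stable : forall x q, q \in X -> lab x q \in X.
Hypothesis cut_lab : forall x, cut x -> {in X, lab x =1 c}.

Let first_cut t : has cut t ->
  exists t1 z t2, [/\ t = t1 ++ z :: t2, ~~ has cut t1 & cut z].
Proof.
elim: t => //= x t IH; case: (boolP (cut x)) => /= [cx _|ncx /IH].
  by exists [::], x, t.
case=> t1 [z [t2 [-> nt1 cz]]].
by exists (x :: t1), z, t2; rewrite /= (negPf ncx).
Qed.

(** For a word starting with a cut, the cuts but the last one produce the factor
    of block labels, and the last one produces the application of [c]. *)
Let run_from_cut p y t q : s = p ++ y :: t -> cut y -> q \in X ->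
  run lab (y :: t) q =
  run (block_lab c) (y :: t) (c (run (keep after_cuts) s q)).
Proof.
have [n] := ubnP (size t); elim: n p y t => // n IH p y t.
rewrite ltnS => le_tn sE cy qX; have [py yt inpyt] := sides sE.
have [_ tr _] := lt_strict.
rewrite run_cons cut_lab //; last exact: run_stable.
have [/first_cut[t1 [z [t2 [tE nt1 cz]]]]|nt] := boolP (has cut t).
  have sE' : s = (p ++ y :: t1) ++ z :: t2 by rewrite sE tE -catA.
  have [pz zt inpzt] := sides sE'.
  have szt : size t2 < n.
    by apply: leq_trans le_tn; rewrite tE size_cat /= addnS ltnS leq_addl.
  have yz : lt y z by apply: yt; rewrite tE mem_cat mem_head orbT.
  have yt1 x : x \in t1 -> lt y x by move=> xt1; apply: yt; rewrite tE mem_cat xt1.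
  have cut_t1 x : x \in t1 -> ~~ cut x.
    by move=> xt1; apply: contra nt1 => cx; apply/hasP; exists x.
  rewrite tE run_cons !run_cat (IH _ _ _ szt sE' cz qX).
  rewrite [run (block_lab c) t1]run_idt => [|x /cut_t1/negbTE cx]; last first.
    by rewrite /block_lab cx.
  have -> : block_lab c y = comp c (run (keep (next_block y)) s).
    by rewrite /block_lab cy ifT //; apply/existsP; exists z; rewrite cz.
  rewrite compE idtE (@run_keep (p ++ [:: y]) t1 (z :: t2) (next_block y)) //
    => [|x|x xt1|x].
  - by rewrite sE' -!catA.
  - rewrite mem_cat inE negb_and => /orP[/py/lt_asym ->|/eqP ->] //.
    by rewrite lt_irr.
  - rewrite /next_block yt1 //=; apply/forallP => w; apply/implyP => /andP[cw yw].
    have xz : lt x z by apply: pz; rewrite mem_cat inE xt1 !orbT.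
    have /or3P[|/eqP -> //|/zt] := inpzt w; last exact: tr.
    rewrite mem_cat inE => /or3P[/py/lt_asym|/eqP wy|/cut_t1]; last by rewrite cw.
      by rewrite yw.
    by rewrite wy lt_irr in yw.
  rewrite inE => zt2; rewrite negb_and; apply/orP; right.
  apply/forallP => /(_ z); rewrite cz yz /=.
  by case/predU1P: zt2 => [->|/zt/lt_asym ->]; rewrite ?lt_irr.
have cut_t x : x \in t -> ~~ cut x.
  by move=> xt; apply: contra nt => cx; apply/hasP; exists x.
have -> : run (block_lab c) (y :: t) = idt.
  apply: run_idt => x; rewrite inE /block_lab => /predU1P[->|/cut_t/negbTE -> //].
  rewrite ifF //; apply/negbTE; rewrite cy; apply/existsP => -[w /andP[cw yw]].
  have /or3P[/py/lt_asym|/eqP wy|/cut_t] := inpyt w; last by rewrite cw.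
    by rewrite yw.
  by rewrite wy lt_irr in yw.
rewrite idtE (@run_keep (p ++ [:: y]) t [::]) // => [|x|x xt].
- by rewrite cats0 -catA.
- rewrite mem_cat inE => xpy; apply/forallP => /(_ y); rewrite cy /=.
  by case/orP: xpy => [/py/lt_asym ->|/eqP ->]; rewrite ?lt_irr.
apply/forallP => w; apply/implyP => cw.
have /or3P[/py wy|/eqP ->|/cut_t] := inpyt w; last by rewrite cw.
  exact: tr wy (yt x xt).
exact: yt.
Qed.

(** A word v0 c v1 c ... c vk, with no cut in the vi, is read as vk, then the
    last c, then the blocks (c v(k-1)), ..., (c v1), then v0. After the last c the
    state is in the image of [c], and the blocks do not leave it. *)
Lemma run_factor q : [exists y, cut y] -> q \in X ->
  run lab s q = run (keep before_cuts) s
                  (run (block_lab c) s (c (run (keep after_cuts) s q))).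
Proof.
case/existsP=> y0 cy0 qX.
have /first_cut[p [y [t [sE np cy]]]] : has cut s by apply/hasP; exists y0.
have [py yt inpyt] := sides sE.
have cutE x : cut x -> x = y \/ x \in t.
  move=> cx; have /or3P[xp|/eqP|] := inpyt x; [|by left|by right].
  by case/negP: np; apply/hasP; exists x.
have [irr tr tot] := lt_strict.
have -> : run (keep before_cuts) s = run lab p.
  apply: (@run_keep [::] p (y :: t)) => // x.
    move=> xp; apply/forallP => z; apply/implyP => /cutE[->|zt]; first exact: py.
    exact: tr (py x xp) (yt z zt).
  move=> xt; apply/forallP => /(_ y); rewrite cy /=.
  by move: xt; rewrite inE => /predU1P[->|/yt/lt_asym ->]; rewrite ?lt_irr.
rewrite [in LHS]sE run_cat (run_from_cut sE cy qX).
rewrite (_ : run (block_lab c) s = run (block_lab c) (y :: t)) //.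
apply/ffunP => q'; rewrite {1}sE run_cat [run _ p]run_idt ?idtE // => x xp.
rewrite /block_lab; case cx: (cut x) => //.
by case/negP: np; apply/hasP; exists x.
Qed.
End Factorisation.
End Transformations.

(** * Aperiodic runs are first-order definable *)

Section Enumeration.
Variables (A : finType) (lt : rel A).

Definition sorted_enum : seq A := sort (fun x y => (x == y) || lt x y) (enum A).

Lemma mem_sorted_enum x : x \in sorted_enum.
Proof. by rewrite mem_sort mem_enum. Qed.

Lemma pairwise_sorted_enum : strict_linear_order lt -> pairwise lt sorted_enum.
Proof.
case=> irr tr tot; pose le : rel A := fun x y => (x == y) || lt x y.
have le_tr : transitive le.
  move=> y x z /orP[/eqP -> //|xy] /orP[/eqP <-|yz]; first by rewrite /le xy orbT.
  by rewrite /le (tr _ _ _ xy yz) orbT.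
have le_tot : total le.
  move=> x y; rewrite /le; case: (eqVneq x y) => //= xy.
  by case/orP: (tot _ _ xy) => ->; rewrite ?orbT.
have : pairwise [rel x y | (x != y) && le x y] (sort le (enum A)).
  by rewrite pairwise_relI -uniq_pairwise sort_uniq enum_uniq
    -sorted_pairwise // sort_sorted.
by apply: sub_pairwise => x y /andP[/= /negPf xy]; rewrite /le xy.
Qed.
End Enumeration.

Lemma run_fix (Q : finType) (A : Type) (lab : A -> {ffun Q -> Q}) s q :
  (forall x, lab x q = q) -> run lab s q = q.
Proof.
by move=> fixq; elim: s => [|x s IH]; rewrite ?run_cons ?IH // /run big_nil idtE.
Qed.

Section DefinableRun.
Variables (Sg : signature) (ok : pred Sg) (K : pred (structure Sg)).
Variable lt : forall A : structure Sg, rel A.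
Arguments lt : clear implicits.
Hypothesis definable_lt : definable_relation ok K lt.
Hypothesis K_lt : forall A, K A -> strict_linear_order (lt A).

Variables (Q : finType) (M : {set {ffun Q -> Q}}) (X0 : {set Q}).
Hypothesis idM : idt Q \in M.
Hypothesis compM : forall f g, f \in M -> g \in M -> comp f g \in M.
Hypothesis aperM : forall f, f \in M ->
  exists n, {in X0, forall q, iter n.+1 f q = iter n f q}.

Definition labelling (V : finType) :=
  forall A : structure Sg, (V -> A) -> A -> {ffun Q -> Q}.

(** Only the behaviour on [X] has to be definable: this is all that the induction
    provides for the block labels. *)
Definition definable_labelling (V : finType) (X : {set Q}) (lab : labelling V) :=
  {in X, forall q r, definable ok K (fun A (g : option V -> A) =>
    lab A (fun v => g (Some v)) (g None) q == r)}.

Let run_in_M (A : Type) (lab : A -> {ffun Q -> Q}) (s : seq A) :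
  (forall x, lab x \in M) -> run lab s \in M.
Proof.
move=> labM; apply: (big_ind (fun f => f \in M)) => // f g; exact: compM.
Qed.

Let definable_keep (V : finType) (X : {set Q}) (lab : labelling V)
    (C : forall A : structure Sg, (V -> A) -> pred A) :
  definable_labelling X lab ->
  definable ok K (fun A (g : option V -> A) => C A (fun v => g (Some v)) (g None)) ->
  definable_labelling X (fun A g => keep (lab A g) (C A g)).
Proof.
move=> dlab dC q qX r; apply: eq_definable (fun A g =>
  if C A (fun v => g (Some v)) (g None)
  then lab A (fun v => g (Some v)) (g None) q == r else q == r) _ _ _.
  by move=> A _ g; rewrite /keep; case: (C _ _ _) => //; rewrite idtE.
by apply: definable_if => //; [apply: dlab|apply: definable_const].
Qed.

(** The same labelling with one more parameter, needed for the block labels,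
    which are themselves runs of a labelling depending on the cut. *)
Let definable_labellingS (V : finType) (X : {set Q}) (lab : labelling V) :
  definable_labelling X lab ->
  definable_labelling X (fun A (g : option V -> A) => lab A (fun v => g (Some v))).
Proof.
move=> dlab q qX r.
exact: (definable_subst (fun o => if o is Some v then Some (Some v) else None)
  (dlab q qX r)).
Qed.

Section Cuts.
Variables (V : finType) (cut : forall A : structure Sg, (V -> A) -> pred A).
Arguments cut : clear implicits.
Hypothesis dcut :
  definable ok K (fun A (g : option V -> A) => cut A (fun v => g (Some v)) (g None)).

Let dcutS : definable ok K (fun A (g : option (option V) -> A) =>
  cut A (fun v => g (Some (Some v))) (g None)).
Proof.
exact: (definable_subst (fun o => if o is Some v then Some (Some v) else None) dcut).
Qed.

Lemma definable_exists_cut :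
  definable ok K (fun A (g : V -> A) => [exists y, cut A g y]).
Proof. exact: (definable_exists (P := fun A g y => cut A g y)). Qed.

Lemma definable_before : definable ok K (fun A (g : option V -> A) =>
  before_cuts (lt A) (cut A (fun v => g (Some v))) (g None)).
Proof.
apply: (definable_forall (P := fun A g y =>
  cut A (fun v => g (Some v)) y ==> lt A (g None) y)).
by apply: definable_imp => //; apply: definable_lt.
Qed.

Lemma definable_after : definable ok K (fun A (g : option V -> A) =>
  after_cuts (lt A) (cut A (fun v => g (Some v))) (g None)).
Proof.
apply: (definable_forall (P := fun A g y =>
  cut A (fun v => g (Some v)) y ==> lt A y (g None))).
by apply: definable_imp => //; apply: definable_lt.
Qed.

Lemma definable_has_next : definable ok K (fun A (g : option V -> A) =>
  has_next (lt A) (cut A (fun v => g (Some v))) (g None)).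
Proof.
apply: (definable_exists (P := fun A g y =>
  cut A (fun v => g (Some v)) y && lt A (g None) y)).
by apply: definable_and => //; apply: definable_lt.
Qed.

Lemma definable_next : definable ok K (fun A (g : option (option V) -> A) =>
  next_block (lt A) (cut A (fun v => g (Some (Some v)))) (g (Some None)) (g None)).
Proof.
apply: definable_and; first exact: definable_lt.
apply: (definable_forall (P := fun A g y =>
  cut A (fun v => g (Some (Some v))) y && lt A (g (Some None)) y ==> lt A (g None) y)).
apply: definable_imp; last exact: definable_lt.
apply: definable_and; last exact: definable_lt.
exact: (definable_subst (fun o => if o is Some v then Some (Some v) else None) dcutS).
Qed.

End Cuts.

(** Induction on the size of the set [X] of states that matter, then on the
    number of letters. Letters are identified with their actions, and neutral
    positions make the identity a letter. The aperiodic monoid [M] is fixed: it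
    contains all block labels, even though these are taken from the larger
    alphabet of all elements of [M] that preserve the smaller set of states. *)
Lemma definable_run (X : {set Q}) (S : {set {ffun Q -> Q}}) :
  X \subset X0 -> S \subset M -> idt Q \in S ->
  (forall f q, f \in S -> q \in X -> f q \in X) ->
  forall (V : finType) (lab : labelling V),
    (forall A g x, K A -> lab A g x \in S) -> definable_labelling X lab ->
    {in X, forall q r, definable ok K (fun A (g : V -> A) =>
      run (lab A g) (sorted_enum (lt A)) q == r)}.
Proof.
have [n] := ubnP #|X|; elim: n X S => // n IHX X S; rewrite ltnS => leXn.
have [m] := ubnP #|S|; elim: m S => // m IHS S; rewrite ltnS => leSm.
move=> XX0 SM idS Sstable V lab labS dlab q qX r.
(* Without a letter acting nontrivially on X, every word fixes q. *)
case: (pickP [pred c in S | [exists q in X, c q != q]]) => [c /= /andP[cS cX]|triv].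
  2: { apply: eq_definable (fun A g => q == r) _ _ _; last exact: definable_const.
    move=> A KA g; rewrite run_fix // => x; apply/eqP; apply: contraFT (triv (lab A g x)).
    by move=> neq; rewrite /= labS //=; apply/existsP; exists q; rewrite qX. }
(* The cuts are the positions that act on X as c; equality with c would not be
   definable. *)
pose agree (f : {ffun Q -> Q}) := [forall p, (p \in X) ==> (f p == c p)].
pose cut (A : structure Sg) (g : V -> A) : pred A := fun x => agree (lab A g x).
have dcut : definable ok K (fun A (g : option V -> A) =>
    cut A (fun v => g (Some v)) (g None)).
  apply: definable_bigand => p; case: (boolP (p \in X)) => [pX|_].
    exact: dlab.
  exact: definable_const.
pose S1 := [set f in S | ~~ agree f].
have ltS1 : #|S1| < m.
  apply: leq_trans leSm; apply: proper_card; apply/properP; split.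
    by apply/subsetP => f; rewrite inE => /andP[].
  exists c => //; rewrite inE cS /= negbK; apply/forallP => p.
  by rewrite eqxx implybT.
have idS1 : idt Q \in S1.
  rewrite inE idS /=; apply/forallP => agr; case/existsP: cX => p /andP[pX].
  by have /implyP/(_ pX) := agr p; rewrite idtE eq_sym => ->.
(* Removing the cuts removes the letter c from the alphabet. *)
have drun_keep (V' : finType) (lab' : labelling V')
    (C : forall A : structure Sg, (V' -> A) -> pred A) :
    (forall A g x, K A -> lab' A g x \in S) -> definable_labelling X lab' ->
    (forall A g x, K A -> C A g x -> ~~ agree (lab' A g x)) ->
    definable ok K (fun A (g : option V' -> A) => C A (fun v => g (Some v)) (g None)) ->
    {in X, forall q r, definable ok K (fun A (g : V' -> A) =>
      run (keep (lab' A g) (C A g)) (sorted_enum (lt A)) q == r)}.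
  move=> lab'S dlab' C_agree dC.
  apply: (IHS S1) => //.
  - by apply: subset_trans SM; apply/subsetP => f; rewrite inE => /andP[].
  - by move=> f p; rewrite inE => /andP[fS _]; apply: Sstable.
  - move=> A g x KA; rewrite /keep; case: ifP => // Cx.
    by rewrite inE lab'S //= C_agree.
  exact: definable_keep.
pose X1 := c @: X.
have X1X : X1 \subset X.
  by apply/subsetP => _ /imsetP[p pX ->]; apply: Sstable.
(* If c were injective on X, then c^(k+1) = c^k would give c = id on X. *)
have ltX1 : #|X1| < n.
  apply: leq_trans leXn; rewrite ltn_neqAle leq_imset_card andbT.
  apply/negP => /imset_injP injc; case/existsP: cX => p /andP[pX /negP]; apply.
  have [k ck] := aperM (subsetP SM c cS).
  have iterX p' j : p' \in X -> iter j c p' \in X.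
    by move=> p'X; elim: j => //= j IHj; apply: Sstable.
  have := ck p (subsetP XX0 p pX); elim: k {ck} => [/eqP //|k IHk /= ck].
  by apply: IHk; apply: injc => //; [apply: (iterX p k.+1)|apply: iterX].
(* The alphabet of the block labels may be large, as X1 is smaller than X. *)
pose S' := [set f in M | [forall p, (p \in X1) ==> (f p \in X1)]].
pose block (A : structure Sg) (g : V -> A) :=
  block_lab (lt A) (sorted_enum (lt A)) (lab A g) (cut A g) c.
have labstable A g : K A -> forall x p, p \in X -> lab A g x p \in X.
  by move=> KA x p; apply: Sstable; apply: labS.
have cX1 p : p \in X -> c p \in X1 by move=> pX; apply: imset_f.
have blockS' A g x : K A -> block A g x \in S'.
  move=> KA; rewrite inE /block /block_lab; case: ifP => _; last first.
    by rewrite idM; apply/forallP => p; rewrite idtE implybb.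
  rewrite compM ?(subsetP SM c) //=; last first.
    apply: run_in_M => z; rewrite /keep; case: ifP => // _.
    by apply: (subsetP SM); apply: labS.
  apply/forallP => p; apply/implyP => /(subsetP X1X) pX; rewrite compE.
  apply: cX1; apply: run_stable => // z p' p'X; rewrite /keep.
  by case: ifP => _; [apply: labstable|rewrite idtE].
have dblock : {in X1, forall q r, definable ok K (fun A (g : V -> A) =>
    run (block A g) (sorted_enum (lt A)) q == r)}.
  apply: (IHX X1 S') => //.
  - exact: subset_trans XX0.
  - by apply/subsetP => f; rewrite inE => /andP[].
  - by rewrite inE idM; apply/forallP => p; rewrite idtE implybb.
  - by move=> f p; rewrite inE => /andP[_ /forallP/(_ p)/implyP].
  move=> p /(subsetP X1X) pX p'.
  apply: eq_definable (fun A g =>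
    if cut A (fun v => g (Some v)) (g None) &&
       has_next (lt A) (cut A (fun v => g (Some v))) (g None)
    then [exists p1 : Q, (run (keep (lab A (fun v => g (Some v)))
          (next_block (lt A) (cut A (fun v => g (Some v))) (g None)))
          (sorted_enum (lt A)) p == p1) && (c p1 == p')]
    else p == p') _ _ _.
    move=> A _ g; rewrite /block /block_lab; case: ifP => _; last by rewrite idtE.
    rewrite compE; apply/existsP/eqP => [[p1 /andP[/eqP -> /eqP //]]|<-].
    by eexists; apply/andP.
  apply: definable_if; last exact: definable_const.
    by apply: definable_and => //; apply: definable_has_next.
  apply: definable_bigor => p1; apply: definable_and; last exact: definable_const.
  apply: (drun_keep _ (fun A (g : option V -> A) => lab A (fun v => g (Some v)))
    (fun A g => next_block (lt A) (cut A (fun v => g (Some v))) (g None))) => //.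
  - by move=> A g x; apply: labS.
  - exact: definable_labellingS.
  - move=> A g x KA /andP[lt_x /forallP/(_ x)]; rewrite lt_x andbT.
    by have [-> _ _] := K_lt KA; rewrite implybF.
  exact: definable_next.
have dbefore : {in X, forall q r, definable ok K (fun A (g : V -> A) =>
    run (keep (lab A g) (before_cuts (lt A) (cut A g))) (sorted_enum (lt A)) q == r)}.
  apply: drun_keep => //; last exact: definable_before.
  by move=> A g x KA /forallP/(_ x); have [-> _ _] := K_lt KA; rewrite implybF.
have dafter : {in X, forall q r, definable ok K (fun A (g : V -> A) =>
    run (keep (lab A g) (after_cuts (lt A) (cut A g))) (sorted_enum (lt A)) q == r)}.
  apply: drun_keep => //; last exact: definable_after.
  by move=> A g x KA /forallP/(_ x); have [-> _ _] := K_lt KA; rewrite implybF.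
apply: eq_definable (fun A g => if [exists y, cut A g y] then
  [exists p1, exists p2, [&& p1 \in X, p2 \in X,
    run (keep (lab A g) (after_cuts (lt A) (cut A g))) (sorted_enum (lt A)) q == p1,
    run (block A g) (sorted_enum (lt A)) (c p1) == p2 &
    run (keep (lab A g) (before_cuts (lt A) (cut A g))) (sorted_enum (lt A)) p2 == r]]
  else run (keep (lab A g) (before_cuts (lt A) (cut A g)))
    (sorted_enum (lt A)) q == r) _ _ _.
  move=> A KA g; have linA := K_lt KA.
  have keep_stable C x p : p \in X -> keep (lab A g) C x p \in X.
    by move=> pX; rewrite /keep; case: ifP => _; [apply: labstable|rewrite idtE].
  have cut_lab x : cut A g x -> {in X, lab A g x =1 c}.
    by move=> /forallP cx p pX; apply/eqP/(implyP (cx p)).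
  case: ifP => [cutx|/negbT nocut]; last first.
    by rewrite run_no_cut.
  rewrite (run_factor linA (pairwise_sorted_enum linA) (mem_sorted_enum (lt A))
    (labstable A g KA) cut_lab cutx qX) -/(block A g).
  set p1 := run (keep _ (after_cuts _ _)) _ q.
  set p2 := run (block A g) _ (c p1).
  apply/existsP/eqP => [[q1 /existsP[q2]]|<-].
    by case/and5P=> _ _ /eqP <- /eqP <- /eqP.
  have p1X : p1 \in X by apply: run_stable => // x p; apply: keep_stable.
  exists p1; apply/existsP; exists p2; rewrite !eqxx p1X !andbT.
  apply/(subsetP X1X)/run_stable => [x p|]; last exact: cX1.
  have := blockS' A g x KA; rewrite inE => /andP[_ /forallP/(_ p)/implyP]; exact.
apply: definable_if; [exact: definable_exists_cut | | exact: dbefore].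
apply: definable_bigor => p1; apply: definable_bigor => p2.
case: (boolP (p1 \in X)) => [p1X|_]; last exact: definable_const.
case: (boolP (p2 \in X)) => [p2X|_]; last exact: definable_const.
rewrite /=; apply: definable_and; first exact: dafter.
by apply: definable_and; [apply: dblock; apply: cX1|apply: dbefore].
Qed.
End DefinableRun.

(** * Constraint topological sorting *)

Section Reach.
Variables (T Sigma : finType) (act : Sigma -> T -> T) (x : T).

Definition reach : {set T} :=
  [set y | connect (fun p q => [exists a, q == act a p]) x y].

Lemma reachP y : y \in reach <-> exists w, y = foldr act x w.
Proof.
rewrite inE; split=> [/connectP[p]|[w ->]].
  elim/last_ind: p y => [|p z IH] y /=; first by move=> _ ->; exists [::].
  rewrite rcons_path last_rcons => /andP[xp /existsP[a /eqP za]] ->.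
  by have [w wE] := IH _ xp erefl; exists (a :: w); rewrite za wE.
elim: w => [|a w IH] /=; first exact: connect0.
by apply: connect_trans IH (connect1 _); apply/existsP; exists a.
Qed.
End Reach.

Section Preimages.
Variables (Sigma : finType) (L : seq Sigma -> Prop) (D : dfa Sigma).
Hypothesis LD : forall w, L w <-> accepts D w.
Hypothesis aperiodic_L : aperiodic L.

Definition states : {set state D} := reach (fun a q => trans q a) (init D).

(** As only reachable states are kept, this set depends only on the left contexts
    of [w] in [L]: such sets are the states of the minimal automaton of the
    reversed language. This makes the aperiodicity of [L] available, which the
    transformations of [D] itself need not share. *)
Definition accepting (w : seq Sigma) : {set state D} :=
  [set q in states | final (foldl (@trans _ D) q w)].

Definition preimage_letter (a : Sigma) : {ffun {set state D} -> {set state D}} :=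
  [ffun G : {set state D} => [set q in states | trans q a \in G]].

Lemma in_accepting w q :
  (q \in accepting w) = (q \in states) && final (foldl (@trans _ D) q w).
Proof. by rewrite in_set. Qed.

Lemma in_preimage_letter a G q :
  (q \in preimage_letter a G) = (q \in states) && (trans q a \in G).
Proof. by rewrite ffunE in_set. Qed.

(** The reachable states of the automaton reading from right to left. *)
Definition suffix_sets : {set {set state D}} :=
  reach preimage_letter (accepting [::]).

Definition word_actions : {set {ffun {set state D} -> {set state D}}} :=
  reach (fun a f => comp (preimage_letter a) f) (idt _).

Lemma states_word q : q \in states <-> exists w, q = foldl (@trans _ D) (init D) w.
Proof.
apply: iff_trans (reachP _ _ _) _; split=> -[w ->].
  by exists (rev w); rewrite foldl_rev.
by exists (rev w); rewrite -foldl_rev revK.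
Qed.

(** Prepending [a] to a word takes the preimage of its set under [a]. *)
Lemma run_accepting u w :
  run preimage_letter u (accepting w) = accepting (u ++ w).
Proof.
elim: u => [|a u IH]; first by rewrite /run big_nil idtE.
rewrite run_cons IH; apply/setP => q; rewrite in_preimage_letter !in_accepting.
case: (boolP (q \in states)) => //= /states_word[x qE].
have -> // : trans q a \in states.
by apply/states_word; exists (rcons x a); rewrite -cats1 foldl_cat -qE.
Qed.

Lemma suffix_setsP G : G \in suffix_sets <-> exists w, G = accepting w.
Proof.
have foldrE w : foldr preimage_letter (accepting [::]) w = accepting w.
  rewrite -[in RHS](cats0 w) -run_accepting.
  by elim: w => [|a w IH]; rewrite ?run_cons -?IH // /run big_nil idtE.
apply: iff_trans (reachP _ _ _) _.
by split=> -[w ->]; exists w; rewrite foldrE.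
Qed.

Lemma word_actionsP f : f \in word_actions <-> exists w, f = run preimage_letter w.
Proof.
have foldrE w : foldr (fun a f => comp (preimage_letter a) f) (idt _) w =
                run preimage_letter w.
  by elim: w => [|a w /= ->]; rewrite /run ?big_nil ?big_cons.
apply: iff_trans (reachP _ _ _) _.
by split=> -[w ->]; exists w; rewrite foldrE.
Qed.

Lemma idt_word_actions : idt _ \in word_actions.
Proof. by apply/word_actionsP; exists [::]; rewrite /run big_nil. Qed.

Lemma letter_word_actions a : preimage_letter a \in word_actions.
Proof. by apply/word_actionsP; exists [:: a]; rewrite /run big_seq1. Qed.

Lemma comp_word_actions f g :
  f \in word_actions -> g \in word_actions -> comp f g \in word_actions.
Proof.
move=> /word_actionsP[u ->] /word_actionsP[v ->]; apply/word_actionsP.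
by exists (u ++ v); rewrite /run big_cat.
Qed.

Lemma word_actions_stable f G :
  f \in word_actions -> G \in suffix_sets -> f G \in suffix_sets.
Proof.
move=> /word_actionsP[u ->] /suffix_setsP[w ->]; apply/suffix_setsP.
by exists (u ++ w); rewrite run_accepting.
Qed.

Lemma final_accepts x u :
  final (foldl (@trans _ D) (foldl (@trans _ D) (init D) x) u) = accepts D (x ++ u).
Proof. by rewrite /accepts foldl_cat. Qed.

(** Reading v^n in front of y leads to the set of reachable states from which
    v^n y is accepted; reachable states are values of words x, so this set only
    depends on the membership of the words x v^n y in [L]. *)
Lemma word_actions_aperiodic f : f \in word_actions ->
  exists n, {in suffix_sets, forall G, iter n.+1 f G = iter n f G}.
Proof.
move=> /word_actionsP[v ->]; have [n vn] := aperiodic_L v; exists n.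
move=> _ /suffix_setsP[y ->].
have iterE k : iter k (run preimage_letter v) (accepting y) =
               accepting (word_pow v k ++ y).
  elim: k => // k IH; rewrite iterS IH run_accepting catA.
  by rewrite /word_pow.
rewrite !iterE; apply/setP => q; rewrite !in_accepting.
case: (boolP (q \in states)) => //= /states_word[x ->]; rewrite !final_accepts.
by apply/idP/idP => /LD/vn/LD.
Qed.

Lemma mem_init_accepting w : init D \in accepting w <-> L w.
Proof.
rewrite in_accepting; have -> : init D \in states by apply/states_word; exists [::].
by split=> /LD.
Qed.

Let prime (_ : unit) : letter_sig Sigma := None.
Let Sg := sig_sum (letter_sig Sigma) (quantified prime).
Let ok := unprimed (prime := prime).

Let lt (A : structure Sg) : rel A := fun x y => @interp Sg A (inr tt) [tuple x; y].
Arguments lt : clear implicits.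

(** An arbitrary structure may have several letters, or none, at an element.
    Going through the whole set of letters gives a label to every element of
    every structure, and the right one if there is exactly one letter. *)
Let letters (A : structure Sg) (x : A) : {ffun Sigma -> bool} :=
  [ffun a => @interp Sg A (inl (Some a)) [tuple x]].
Arguments letters : clear implicits.

Let position_action (A : structure Sg) (x : A) :=
  if [pick a | letters A x a] is Some a then preimage_letter a else idt _.

Let linear (A : structure Sg) : bool :=
  [&& [forall x, ~~ lt A x x],
      [forall x, forall y, forall z, lt A y x && lt A x z ==> lt A y z]
    & [forall x, forall y, (x != y) ==> lt A x y || lt A y x]].

Let linearP A : linear A <-> strict_linear_order (lt A).
Proof.
split=> [/and3P[/forallP irr /forallP tr /forallP tot]|[irr tr tot]].
  split=> [x|x y z yx xz|x y]; first exact: negbTE.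
    have /forallP/(_ y)/forallP/(_ z)/implyP := tr x.
    by rewrite yx xz; apply.
  by have /forallP/(_ y)/implyP := tot x.
apply/and3P; split; apply/forallP => x; first by rewrite irr.
  apply/forallP => y; apply/forallP => z; apply/implyP => /andP[]; exact: tr.
by apply/forallP => y; apply/implyP; apply: tot.
Qed.

Let definable_lt K : definable_relation ok K lt.
Proof.
by move=> V v w; apply: (@definable_rel Sg _ _ _ (inr tt) [tuple v; w]).
Qed.

Let definable_linear : definable ok predT (fun A (_ : void -> A) => linear A).
Proof.
apply: definable_and; [|apply: definable_and].
- apply: (definable_forall (P := fun A _ x => ~~ lt A x x)).
  by apply: definable_neg; apply: definable_lt.
- apply: (definable_forall2 (P := fun (A : structure Sg) x y =>
    [forall z, lt A y x && lt A x z ==> lt A y z])).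
  apply: (definable_forall (P := fun (A : structure Sg) g z =>
    lt A (g None) (g (Some None)) && lt A (g (Some None)) z ==> lt A (g None) z)).
  apply: definable_imp; last exact: definable_lt.
  by apply: definable_and; apply: definable_lt.
apply: (definable_forall2 (P := fun (A : structure Sg) x y =>
    (x != y) ==> lt A x y || lt A y x)).
apply: definable_imp; first by apply: definable_neg; apply: definable_eq.
by apply: definable_or; apply: definable_lt.
Qed.

Let accepted (A : structure Sg) : bool :=
  init D \in run (position_action (A := A)) (sorted_enum (lt A)) (accepting [::]).

Let definable_accepted : definable ok linear (fun A (_ : void -> A) => accepted A).
Proof.
apply: eq_definable (fun (A : structure Sg) g => [exists G : {set state D},
  (run (position_action (A := A)) (sorted_enum (lt A)) (accepting [::]) == G) &&
  (init D \in G)]) _ _ _.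
  move=> A _ g; apply/existsP/idP => [[G /andP[/eqP <-]] //|acc].
  exists (run (position_action (A := A)) (sorted_enum (lt A)) (accepting [::])).
  by rewrite eqxx.
apply: definable_bigor => G; apply: definable_and; last exact: definable_const.
apply: (@definable_run Sg ok linear lt (@definable_lt linear) _ _
  word_actions suffix_sets _ _ _ suffix_sets word_actions _ _ _ _ void
  (fun A (_ : void -> A) => position_action (A := A))).
- by move=> A /linearP.
- exact: idt_word_actions.
- exact: comp_word_actions.
- exact: word_actions_aperiodic.
- exact: subxx.
- exact: subxx.
- exact: idt_word_actions.
- exact: word_actions_stable.
- move=> A g x _; rewrite /position_action.
  by case: pickP => [a _|_]; [apply: letter_word_actions|apply: idt_word_actions].
- move=> H _ H'.
  apply: eq_definable (fun (A : structure Sg) g => [exists p : {ffun Sigma -> bool},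
    [forall a, @interp Sg A (inl (Some a)) [tuple g None] == p a] &&
    ((if [pick a | p a] is Some a then preimage_letter a else idt _) H == H')]) _ _ _.
    move=> A _ g; apply/existsP/idP => [[p /andP[/forallP lp]]|eqH].
      have -> // : p = letters A (g None).
      by apply/ffunP => a; rewrite ffunE; apply/esym/eqP.
    exists (letters A (g None)); apply/andP; split=> //.
    by apply/forallP => a; rewrite ffunE.
  apply: definable_bigor => p; apply: definable_and; last exact: definable_const.
  apply: definable_bigand => a; apply: definable_iff; last exact: definable_const.
  apply: (@definable_rel Sg _ _ _ (inl (Some a)) [tuple None]) => //.
  by apply/codomP => -[].
apply/suffix_setsP; by exists [::].
Qed.

(** The edge symbol is the only one that is extended, so letters remain available
    to the formula. *)
Lemma topological_sort_eso :
  exists Phi : eso (letter_sig Sigma), extensional Phi /\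
    forall (V : finType) (V_gt0 : 0 < #|V|) (E : rel V) (lab : V -> Sigma),
      models (labelled_structure V_gt0 E lab) Phi <->
      exists lt : rel V, topological_sort E lt /\ L (reading lt lab).
Proof.
have prime_inj : injective prime by case=> -[].
have [Phi [extPhi PhiP]] := extensional_eso prime_inj
  (definable_and_promise definable_linear definable_accepted).
exists Phi; split=> // V V_gt0 E lab; apply: iff_trans (PhiP _) _.
set B := labelled_structure V_gt0 E lab.
have acceptedE (J : forall R : quantified prime, pred ((ar R).-tuple B)) :
    accepted (expansion J) <-> L (reading (fun x y => J tt [tuple x; y]) lab).
  apply: iff_trans (mem_init_accepting _).
  rewrite -[reading _ _]cats0 -run_accepting /accepted /run big_map.
  have actE x : position_action (A := expansion J) x = preimage_letter (lab x).
    rewrite /position_action; case: pickP => [a|/(_ (lab x))].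
      by rewrite ffunE => /eqP <-.
    by rewrite ffunE => /negbT/eqP[].
  by rewrite (eq_bigr _ (fun x _ => actE x)).
split=> [[J [subJ /andP[/linearP lin /acceptedE acc]]]|[r [[lin Er] Lr]]].
  exists (fun x y => J tt [tuple x; y]); split=> //; split=> // x y Exy.
  exact: (subJ tt [tuple x; y]).
exists (fun _ t => r (tnth t ord0) (tnth t ord_max)); split.
  by move=> R t; apply: Er.
by apply/andP; split; [apply/linearP|apply/acceptedE].
Qed.
End Preimages.

Theorem mainTheorem12 :
  (* (a) surjective CSPs *)
  (forall (tau : signature) (B : structure tau),
     exists Phi : eso tau, extensional Phi /\
       forall A : structure tau,
         models A Phi <->
         exists h : A -> B, homomorphism h /\ surjective h)
  /\
  (* (b) graph sandwich problems *)
  (forall (I : finType) (F : I -> digraph),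
     (forall i, symmetric (@edge (F i))) ->
     exists Phi : eso two_rel_sig, extensional Phi /\
       forall (V : finType) (V_gt0 : 0 < #|V|) (E N : rel V),
         symmetric E -> symmetric N ->
         (models (two_rel_structure V_gt0 E N) Phi <->
          exists E' : rel V, sandwich_solution F E N E'))
  /\
  (* (c) orientation completion problems *)
  (forall (I : finType) (F : I -> digraph),
     (forall i, oriented (@edge (F i))) ->
     exists Phi : eso two_rel_sig, extensional Phi /\
       forall (V : finType) (V_gt0 : 0 < #|V|) (E A' : rel V),
         partially_oriented E A' ->
         (models (two_rel_structure V_gt0 E A') Phi <->
          exists A : rel V, orientation_completion F E A' A))
  /\
  (* (d) constraint topological sorting *)
  (forall (Sigma : finType) (L : seq Sigma -> Prop),
     regular L -> aperiodic L ->
     exists Phi : eso (letter_sig Sigma), extensional Phi /\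
       forall (V : finType) (V_gt0 : 0 < #|V|) (E : rel V) (lab : V -> Sigma),
         acyclic E ->
         (models (labelled_structure V_gt0 E lab) Phi <->
          exists lt : rel V, topological_sort E lt /\ L (reading lt lab))).
Proof.
split; first exact: surjective_homomorphism_eso.
split.
  move=> I F _; have [Phi [extPhi PhiP]] := sandwich_eso F.
  by exists Phi; split=> // V V_gt0 E N _ _; apply: PhiP.
split.
  move=> I F _; have [Phi [extPhi PhiP]] := orientation_completion_eso F.
  by exists Phi; split=> // V V_gt0 E A' _; apply: PhiP.
move=> Sigma L [D LD] aperL; have [Phi [extPhi PhiP]] := topological_sort_eso LD aperL.
by exists Phi; split=> // V V_gt0 E lab _; apply: PhiP.
Qed.
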